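(* Let $L$ be a multiplicative lattice. If a class $\Sigma_L$ of elements of $L$ contains the element $0$, then the lower space $\Sigma_L$ is connected.
   Context: A multiplicative lattice is a complete lattice $(L,\leqslant,0,1)$ with a binary operation $\cdot$ that is associative, commutative, satisfies $x\cdot 1=x$, and satisfies $x\cdot\bigvee_{\lambda\in\Lambda}y_\lambda=\bigvee_{\lambda\in\Lambda}(x\cdot y_\lambda)$ for all $x\in L$ and all families $(y_\lambda)_{\lambda\in\Lambda}$ in $L$. $x^n$ is the $n$-fold product. Element $x$ is proper if $x\neq 1$. A proper $p$ is prime if $x\cdot y\leqslant p$ implies $x\leqslant p$ or $y\leqslant p$; a prime $p$ is minimal prime if there is no prime $q\neq p$ with $q\leqslant p$. A proper $m$ is maximal if $m\leqslant n$ and $n\neq 1$ imply $m=n$. An element $c$ is compact if $c\leqslant\bigvee_{\lambda\in\Lambda}x_\lambda$ implies $c\leqslant\bigvee_{i=1}^n x_{\lambda_i}$ for some finite subfamily. $x$ is idempotent if $x\cdot x=x$, nilpotent if $x^n=0$ for some $n\geq 1$. The radical of $x$ is $\sqrt{x}=\bigvee\{y\in L\mid y \text{ compact},\ y^n\leqslant x \text{ for some } n\geq 1\}=\bigwedge\{p \text{ prime}\mid x\leqslant p\}$ (the two expressions are taken to agree); $r$ is a radical element if $r=\sqrt r$. $q$ is primary if $x\cdot y\leqslant q$ implies $x\leqslant q$ or $y\leqslant\sqrt q$. $s$ is strongly irreducible if $x\wedge y\leqslant s$ implies $x\leqslant s$ or $y\leqslant s$; irreducible if $x\wedge y=s$ implies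 $x=s$ or $y=s$; completely irreducible if $s=\bigwedge_{\lambda\in\Lambda}x_\lambda$ implies $s=x_\lambda$ for some $\lambda$. A class $\Sigma_L$ of elements of $L$ is any one of the sets of: proper, prime, minimal prime, maximal, compact, idempotent, nilpotent, radical, primary, strongly irreducible, irreducible, completely irreducible elements of $L$. For $x\in L$ put $v(x)=\{l\in\Sigma_L\mid x\leqslant l\}$. The lower space $\Sigma_L$ is the set $\Sigma_L$ with the lower topology, i.e. the topology for which $\{v(x)\mid x\in L\}$ is a subbasis of closed sets. *)

(* Defs.v *)
From HB Require Import structures.
From mathcomp Require Import all_boot all_order.
From mathcomp Require Import all_classical topology.

Set Implicit Arguments.
Unset Strict Implicit.
Unset Printing Implicit Defensive.

Import Order.TTheory.

Local Open Scope classical_set_scope.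

HB.mixin Record isCompleteLattice (d : Order.disp_t) L of Order.TBLattice d L := {
  bigjoin : set L -> L;
  bigjoinP : forall A : set L, supremums A (bigjoin A);
}.

#[short(type="completeLatticeType")]
HB.structure Definition CompleteLattice (d : Order.disp_t) :=
  { L of isCompleteLattice d L & Order.TBLattice d L }.

HB.mixin Record isMultLattice (d : Order.disp_t) L of CompleteLattice d L := {
  lmul : L -> L -> L;
  lmulA : associative lmul;
  lmulC : commutative lmul;
  lmulx1 : right_id (\top%O : L) lmul;
  lmul_bigjoin : forall (x : L) (Y : set L),
    lmul x (bigjoin Y) = bigjoin [set lmul x y | y in Y];
}.

#[short(type="multLatticeType")]
HB.structure Definition MultLattice (d : Order.disp_t) :=
  { L of isMultLattice d L & CompleteLattice d L }.

Section Elements.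
Context (d : Order.disp_t) (L : multLatticeType d).
Implicit Types (x y p q m c r s : L) (A F : set L).

Local Notation one := (\top%O : L).
Local Notation zero := (\bot%O : L).

Definition lexp x (n : nat) : L := iter n (lmul x) one.

Definition proper_elt x := x <> one.

Definition prime_elt p :=
  proper_elt p /\
  forall x y, (lmul x y <= p)%O -> (x <= p)%O \/ (y <= p)%O.

Definition minimal_prime_elt p :=
  prime_elt p /\ ~ exists q, [/\ prime_elt q, q <> p & (q <= p)%O].

Definition maximal_elt m :=
  proper_elt m /\ forall n : L, (m <= n)%O -> n <> one -> m = n.

(* The finite subfamily may be empty, so that 0 is compact. *)
Definition compact_elt c :=
  forall A, (c <= bigjoin A)%O ->
  exists F, [/\ finite_set F, F `<=` A & (c <= bigjoin F)%O].

Definition idempotent_elt x := lmul x x = x.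

Definition nilpotent_elt x := exists2 n : nat, (0 < n)%N & lexp x n = zero.

(* The equality of this join with the meet of the primes above x is not
   assumed: it can fail in a lattice with few compact elements. *)
Definition radical x : L :=
  bigjoin [set y | compact_elt y /\ exists2 n : nat, (0 < n)%N & (lexp y n <= x)%O].

Definition radical_elt r := r = radical r.

Definition primary_elt q :=
  forall x y, (lmul x y <= q)%O -> (x <= q)%O \/ (y <= radical q)%O.

Definition strongly_irreducible_elt s :=
  forall x y, (Order.meet x y <= s)%O -> (x <= s)%O \/ (y <= s)%O.

Definition irreducible_elt s :=
  forall x y, Order.meet x y = s -> x = s \/ y = s.

Definition completely_irreducible_elt s :=
  forall A, infimums A s -> A s.

End Elements.

Variant element_class :=
  | Proper
  | Prime
  | MinimalPrime
  | Maximal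
  | Compact
  | Idempotent
  | Nilpotent
  | Radical
  | Primary
  | StronglyIrreducible
  | Irreducible
  | CompletelyIrreducible.

Definition class_set (d : Order.disp_t) (L : multLatticeType d)
    (k : element_class) : set L :=
  match k with
  | Proper => @proper_elt d L
  | Prime => @prime_elt d L
  | MinimalPrime => @minimal_prime_elt d L
  | Maximal => @maximal_elt d L
  | Compact => @compact_elt d L
  | Idempotent => @idempotent_elt d L
  | Nilpotent => @nilpotent_elt d L
  | Radical => @radical_elt d L
  | Primary => @primary_elt d L
  | StronglyIrreducible => @strongly_irreducible_elt d L
  | Irreducible => @irreducible_elt d L
  | CompletelyIrreducible => @completely_irreducible_elt d L
  end.
Arguments class_set {d} L k.

Section LowerSpace.
Context (d : Order.disp_t) (L : porderType d) (S : set L).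

Definition lower_space : Type := {x : L | x \in S}.

HB.instance Definition _ := Choice.on lower_space.

Definition lower_closed (x : L) : set lower_space :=
  [set l | (x <= val l)%O].

HB.instance Definition _ := isSubBaseTopological.Build lower_space
  [set ~` lower_closed x | x in [set: L]] id.

End LowerSpace.

(* Main.v *)
(** The point 0 is dense: a subbasic open set [~` v(x)] that misses 0 has
    x <= 0, hence is empty, so every nonempty open set contains 0.  A space with a
    connected dense subset is connected. *)
Require Import Defs.
From HB Require Import structures.
From mathcomp Require Import all_boot all_order.
From mathcomp Require Import all_classical topology.

Import Order.TTheory.

Local Open Scope classical_set_scope.

(** The complement of each [lower_closed x] is a down-set, hence so is every open set. *)
Lemma open_lower_space_least (d : Order.disp_t) (L : porderType d) (S : set L)
    (z : lower_space S) (U : set (lower_space S)) :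
  (forall x : L, x \in S -> (val z <= x)%O) -> open U -> U !=set0 -> U z.
Proof.
(* [U] is a union of finite intersections of subbasic sets; [z] lies in the one, [V], that contains
   [y]. *)
move=> zmin [D' sD <-] [y [V D'V Vy]].
exists V => //.
have [F FD VE] := sD _ D'V.
rewrite -VE in Vy *.
move=> W FW; have := Vy W FW.
have [x _ <-] := set_mem (FD _ FW).
by move=> nxy xz; apply: nxy; apply: (le_trans xz); apply: zmin (valP y).
Qed.

Theorem theorem2p19 (d : Order.disp_t) (L : multLatticeType d)
    (k : element_class) :
  class_set L k \bot%O ->
  connected [set: lower_space (class_set L k)]%classic.
Proof.
move=> /mem_set S0.
pose z : lower_space (class_set L k) := exist _ \bot%O S0.
suff <- : closure [set z] = setT by apply: connected_closure; exact: connected1.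
(* Any neighbourhood [A] of [y] contains an open [U] around [y], and [U] contains [z]. *)
apply/seteqP; split=> // y _ A; rewrite nbhsE => -[U [oU Uy] UA].
exists z; split=> //; apply: UA.
apply: open_lower_space_least oU _; last by exists y.
by move=> x _; exact: le0x.
Qed.
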